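(* Let $q$ be a power of a prime $p$. Let $e$ and $k$ be nontrivial divisors of $q-1$ such that $k$ is a prime and $q=ek+1$. If $$p>(3^{k-1}k)^{1/\operatorname{ord}_k(p)},$$ then $(a,b)\le 2$ for all $a,b\in\mathbb{Z}$, where $(a,b)$ denotes the cyclotomic number of order $e$ over $\mathbb{F}_q$.
   Context: A nontrivial divisor of $q-1$ is a divisor different from $1$ and $q-1$. $\operatorname{ord}_k(p)$ is the multiplicative order of $p$ modulo $k$. Fix a primitive element $g$ of the finite field $\mathbb{F}_q$. For $a\in\mathbb{Z}$ let $C_a=\{g^a,g^{a+e},\dots,g^{a+(k-1)e}\}$, so that $C_a=C_{a+e}$. The cyclotomic number $(a,b)$ of order $e$ is the number of solutions of $1+x=y$ with $x\in C_a$, $y\in C_b$; equivalently, the number of pairs of integers $(r,s)$ with $0\le r,s\le k-1$ and $1+g^{a+re}=g^{b+se}$. It depends only on $a,b$ modulo $e$. *)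

(* Defs.v *)
From mathcomp Require Import all_boot all_order all_algebra all_fingroup.
From mathcomp Require Import reals exp.

Set Implicit Arguments.
Unset Strict Implicit.
Unset Printing Implicit Defensive.

Import Order.TTheory GRing.Theory Num.Theory.

Local Open Scope ring_scope.

Definition nontrivial_divisor (d m : nat) : bool :=
  [&& d %| m, d != 1 & d != m]%N.

(* Order of p in the group of units of Z/kZ, for 1 < k and p coprime to k.
   If p is not a unit mod k, insubd returns the unit 1, whence the value 1. *)
Definition mult_order (k p : nat) : nat :=
  #[insubd (1%g : {unit 'Z_k}) (p%:R : 'Z_k)]%g.

Section Cyclotomic.
Variables (F : finFieldType) (g : F) (e k : nat).

Definition cyclotomic_class (a : int) : {set F} :=
  [set g ^ (a + (r * e)%N%:Z) | r : 'I_k].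

Definition cyclotomic_number (a b : int) : nat :=
  #|[set xy : F * F | [&& xy.1 \in cyclotomic_class a,
                          xy.2 \in cyclotomic_class b & 1 + xy.1 == xy.2]]|.

End Cyclotomic.

(* Main.v *)
Require Import Defs.
From mathcomp Require Import all_boot all_order all_algebra all_fingroup.
From mathcomp Require Import all_solvable all_field.
From mathcomp Require Import reals exp.
From mathcomp Require Import ring.

(** Let [H] be the group of [k]-th roots of unity in the field [F].  Three
    solutions of [1 + x = y] with [x] in [C_a] and [y] in [C_b] are three points
    on a line, and expanding the corresponding 3 by 3 determinant gives
    [P1 + P2 + P3 = N1 + N2 + N3], where the [Pi] and [Nj] lie, after scaling, in
    [H], satisfy [P1 P2 P3 = N1 N2 N3], and no [Pi] is an [Nj]
    ([at_most_two_solutions]).  It has to be shown that [F] has no such relation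
    ([triples_meet]).

    A relation between elements of [H] lifts to a combination of complex [k]-th
    roots of unity, with the same integer coefficients.  Multiplication by the
    lift is an integer matrix which, modulo [p], annihilates the Vandermonde
    vectors of all the Frobenius conjugates of a primitive [k]-th root of unity.
    There are [ord_k(p)] of them, so [p^ord_k(p)] divides the norm of the lift
    ([dvdz_prod_horner_roots]).  On the other hand, Parseval's identity and the
    inequality of arithmetic and geometric means bound this norm in terms of the
    sum [S] of the squared coefficients ([vanishing_sum_bound]): if [S <= 9], it
    is less than [3^(k-1) k].  Under the hypothesis on [p], the lift of a relation
    with [S <= 9] is therefore zero ([large_order_rigid]).

    The relation between the [Pi] and the [Nj] has [S = 6] if the [Pi] are
    distinct and the [Nj] are distinct, and [S = 8] if there is one coincidence.
    In the remaining cases the condition on the products lets the relation factor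
    into relations with [S <= 6].  If both sides have a repetition, one factor is
    [N'P + N'N = 2P^2] ([double_coincidence]).  If one side is constant, the
    relation becomes [A + B + C = 3] with [ABC = 1], and in terms of cube roots it
    is an instance of the factorisation of [a^3 + b^3 + c^3 - 3abc]
    ([no_cubic_coincidence]). *)

Set Implicit Arguments.
Unset Strict Implicit.
Unset Printing Implicit Defensive.

Import Order.TTheory GRing.Theory Num.Theory.

Local Open Scope ring_scope.

(** * Norms of integer polynomials and common roots modulo p *)

Lemma Vandermonde_unitmx (K : fieldType) (d : nat) (x : 'I_d -> K) :
  injective x -> Vandermonde d (\row_i x i) \in unitmx.
Proof.
move=> x_inj; rewrite unitmxE det_Vandermonde unitfE.
apply/prodf_neq0 => i _; apply/prodf_neq0 => j lt_ij.
by rewrite !mxE subr_eq0 (inj_eq x_inj); apply: contraTneq lt_ij => ->; rewrite ltnn.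
Qed.

(** The top [t] rows already form an invertible square Vandermonde matrix. *)
Lemma rank_Vandermonde (K : fieldType) (d t : nat) (x : 'I_t -> K) :
  injective x -> (t <= d)%N -> (t <= \rank (Vandermonde d (\row_i x i)))%N.
Proof.
move=> x_inj le_td; set V := Vandermonde d _.
have V_top : rowsub (widen_ord le_td) V = Vandermonde t (\row_i x i).
  by apply/matrixP => i j; rewrite !mxE.
have /mxrank_unit {1}<- := Vandermonde_unitmx x_inj.
by rewrite -V_top rowsubE mxrankS ?submxMl.
Qed.

(** Adding to the diagonal matrix the indicator of its zero entries makes it
    invertible, so these entries make up for the whole corank. *)
Lemma diag_mx_corank (K : fieldType) (d : nat) (a : 'rV[K]_d) :
  (d - \rank (diag_mx a) <= #|[set i | a ord0 i == 0%R]|)%N.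
Proof.
set Z := [set i | _]; pose b : 'rV[K]_d := \row_i (i \in Z)%:R.
have rank_b : (\rank (diag_mx b) <= #|Z|)%N.
  have -> : diag_mx b = \sum_(i in Z) delta_mx i i.
    rewrite diag_mx_sum_delta [RHS]big_mkcond /=; apply: eq_bigr => i _.
    by rewrite mxE; case: (i \in Z); rewrite ?scale1r ?scale0r.
  rewrite -sum1_card; elim/big_ind2: _ => [|A m B n leA leB|i _].
  - by rewrite mxrank0.
  - by apply: leq_trans (mxrank_add _ _) (leq_add leA leB).
  - by rewrite mxrank_delta.
rewrite leq_subLR; apply: leq_trans (leq_add (leqnn _) rank_b).
apply: leq_trans (mxrank_add _ _); rewrite -raddfD /= mxrank_unit //.
rewrite unitmxE det_diag unitfE; apply/prodf_neq0 => i _.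
by rewrite !mxE inE; case: (eqVneq (a 0 i) 0) => [->|]; rewrite ?add0r ?oner_eq0 ?addr0.
Qed.

(** In Smith normal form the determinant is, up to a sign, the product of the
    invariant factors, and those divisible by [p] are the ones that vanish in
    characteristic [p]; hence each dimension of corank contributes a factor
    [p]. *)
Lemma dvdz_det_of_corank (K : fieldType) (p d t : nat) (A : 'M[int]_d) :
  p \in [pchar K] ->
  (\rank (map_mx (intr : int -> K) A) + t <= d)%N ->
  ((p ^ t)%N%:Z %| \det A)%Z.
Proof.
move=> charKp; have [L L_unit [R R_unit [s _ ->]]] := int_Smith_normal_form A.
set D := \matrix_(_, _) _; have -> : D = diag_mx (\row_i s`_i).
  by apply/matrixP => i j; rewrite !mxE.
rewrite !map_mxM /= map_diag_mx; set a := map_mx _ (\row_i s`_i) => rank_le.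
have unitF M : M \in unitmx -> row_free (map_mx (intr : int -> K) M : 'M_d).
  by move=> uM; rewrite row_free_unit unitmxE det_map_mx rmorph_unit -?unitmxE.
have {rank_le} : (\rank (diag_mx a) + t <= d)%N.
  move: rank_le; rewrite mxrankMfree ?unitF // -mxrank_tr trmx_mul.
  by rewrite map_trmx mxrankMfree ?unitF ?unitmx_tr // mxrank_tr.
have := diag_mx_corank a; set Z := [set i | _] => le_Z le_d.
have {le_Z} le_tZ : (t <= #|Z|)%N.
  by apply: leq_trans le_Z; rewrite leq_subRL ?rank_leq_row.
rewrite !det_mulmx det_diag; apply/dvdz_mulr/dvdz_mull.
rewrite (bigID (mem Z)) /=; apply/dvdz_mulr.
apply: (@dvdz_trans (p ^ #|Z|)%N%:Z); first by rewrite dvdzE /= dvdn_exp2l.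
rewrite -prod_nat_const; elim/big_ind2: _ => // [m x n y|i].
  by rewrite PoszM; apply: dvdz_mul.
by rewrite inE !mxE -(dvdz_pcharf charKp).
Qed.

(** The matrix on the left describes multiplication by [f] on [Z[X]/(Phi)] in
    the basis of powers of [X]; evaluating at a root of [Phi] diagonalises it,
    over any field. *)
Lemma mulmod_Vandermonde (K : fieldType) (Phi f : {poly int}) (d t : nat)
    (x : 'I_t -> K) :
  Phi \is monic -> size Phi = d.+1 ->
  (forall i, root (map_poly intr Phi) (x i)) ->
  map_mx intr (\matrix_(i < d, j < d) (Pdiv.CommonRing.rmodp ('X^i * f) Phi)`_j)
    *m Vandermonde d (\row_i x i) =
  Vandermonde d (\row_i x i) *m diag_mx (\row_i (map_poly intr f).[x i]).
Proof.
move=> Phi_monic szPhi rootPhi; apply/matrixP => i l.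
rewrite mul_mx_diag !mxE.
pose r := Pdiv.CommonRing.rmodp ('X^i * f) Phi.
have szr : (size (map_poly (intr : int -> K) r) <= d)%N.
  apply: leq_trans (size_poly _ _) _.
  by rewrite -ltnS -szPhi Pdiv.CommonRing.ltn_rmodpN0 // monic_neq0.
have := congr1 (fun g => (map_poly (intr : int -> K) g).[x l])
  (Pdiv.RingMonic.rdivp_eq Phi_monic ('X^i * f)).
rewrite -/r rmorphD !rmorphM /= map_polyXn hornerD !hornerM hornerXn.
rewrite (rootP (rootPhi l)) mulr0 add0r => ->.
rewrite (horner_coef_wide _ szr); apply: eq_bigr => j _.
by rewrite !mxE coef_map.
Qed.

(** The product of the values of [f] at the roots of [Phi] is the determinant of
    multiplication by [f] on [Z[X]/(Phi)].  A common root of [f] and [Phi] in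
    characteristic [p] gives a Vandermonde column in the kernel of this matrix
    mod [p], so [t] common roots give a corank of at least [t].  This replaces
    the factorisation of [p] into prime ideals in the number ring. *)
Lemma dvdz_prod_horner_roots (L K : fieldType) (p d t : nat) (Phi f : {poly int})
    (r : 'I_d -> L) (x : 'I_t -> K) :
  p \in [pchar K] -> Phi \is monic -> size Phi = d.+1 ->
  injective r -> (forall i, root (map_poly intr Phi) (r i)) ->
  injective x -> (forall i, root (map_poly intr Phi) (x i)) ->
  (forall i, root (map_poly intr f) (x i)) ->
  exists2 N : int, N%:~R = \prod_i (map_poly intr f).[r i] & ((p ^ t)%N%:Z %| N)%Z.
Proof.
move=> charKp Phi_monic szPhi r_inj rootr x_inj rootx fx0.
have le_td : (t <= d)%N.
  have := @max_poly_roots K (map_poly intr Phi) (codom x).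
  rewrite size_codom card_ord size_map_poly_id0 ?szPhi; last first.
    by rewrite (monicP Phi_monic) oner_eq0.
  apply; first by apply/monic_neq0/monic_map.
    by apply/allP => _ /codomP[i ->].
  by rewrite /codom map_inj_uniq ?enum_uniq.
pose A := \matrix_(i < d, j < d) (Pdiv.CommonRing.rmodp ('X^i * f) Phi)`_j.
exists (\det A).
  have /(congr1 determinant) := mulmod_Vandermonde f Phi_monic szPhi rootr.
  rewrite -/A !det_mulmx mulrC det_map_mx det_diag => /mulfI -> //.
    by apply: eq_bigr => i _; rewrite mxE.
  by rewrite -unitfE -unitmxE Vandermonde_unitmx.
apply: (dvdz_det_of_corank charKp).
have AV0 : map_mx (intr : int -> K) A *m Vandermonde d (\row_i x i) = 0.
  rewrite mulmod_Vandermonde //; apply/matrixP => i j.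
  by rewrite mul_mx_diag !mxE (rootP (fx0 j)) mulr0.
apply: leq_trans (mulmx0_rank_max AV0).
by rewrite leq_add2l rank_Vandermonde.
Qed.

(** * Vanishing sums of roots of unity in characteristic p *)

Definition coef_sum (T : Type) (l : seq (int * T)) : int := \sum_(c <- l) c.1.

(** A list of pairs (coefficient, element) stands for an element of a group ring,
    and the same element may occur in several pairs; [coef_norm] is the sum of
    the squares of the coefficients that remain after equal elements have been
    collected. *)
Definition coef_norm (T : eqType) (l : seq (int * T)) : int :=
  \sum_(c <- l) \sum_(c' <- l) c.1 * c'.1 * (c.2 == c'.2)%:R.

Definition exponential_sum (R : pzRingType) (k : nat) (x : R)
    (l : seq (int * 'I_k)) : R :=
  \sum_(c <- l) c.1%:~R * x ^+ c.2.

Lemma sum_unity_root (R : idomainType) (k : nat) (y : R) :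
  y ^+ k = 1 -> \sum_(j < k) y ^+ j = k%:R * (y == 1)%:R.
Proof.
move=> yk1; have [->|y_neq1] := eqVneq y 1.
  rewrite mulr1 (eq_bigr (fun=> 1)) => [|j _]; last by rewrite expr1n.
  by rewrite sumr_const card_ord.
apply/eqP; rewrite mulr0; have /eqP := subrX1 y k.
by rewrite yk1 subrr eq_sym mulf_eq0 subr_eq0 (negPf y_neq1).
Qed.

Lemma Parseval (k : nat) (w : algC) (l : seq (int * 'I_k)) :
  k.-primitive_root w ->
  \sum_(j < k) `|exponential_sum (w ^+ j) l| ^+ 2 =
  (k%:R * coef_norm l)%:~R.
Proof.
move=> w_prim; have wk1 := prim_expr_order w_prim.
have k_gt0 := prim_order_gt0 w_prim.
have w_conj : w^* = w^-1.
  have /eqP nw1 : `|w| == 1.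
    by rewrite -(pexpr_eq1 k_gt0) // -normrX wk1 normr1.
  by rewrite invC_norm nw1 expr1n invr1 mul1r.
transitivity (\sum_(j < k) \sum_(c <- l) \sum_(c' <- l)
    (c.1 * c'.1)%:~R * (w ^+ c.2 / w ^+ c'.2) ^+ j : algC).
  apply: eq_bigr => j _; rewrite normCK rmorph_sum mulr_suml.
  apply: eq_bigr => c _; rewrite mulr_sumr; apply: eq_bigr => c' _.
  rewrite rmorphM /= rmorph_int !rmorphXn /= w_conj rmorphM /=.
  by rewrite -!exprM exprMn -!exprVn -!exprM ![(_ * j)%N]mulnC mulrACA.
rewrite exchange_big /coef_norm mulr_sumr rmorph_sum; apply: eq_bigr => c _ /=.
rewrite exchange_big mulr_sumr rmorph_sum; apply: eq_bigr => c' _ /=.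
rewrite -mulr_sumr sum_unity_root; last first.
  by rewrite exprMn exprVn -!exprM ![(_ * k)%N]mulnC !exprM wk1 !expr1n invr1 mulr1.
have w_unit (i : nat) : w ^+ i \is a GRing.unit.
  by rewrite unitrX // unitfE (prim_root_eq0 w_prim) -lt0n.
rewrite -(inj_eq (mulIr (w_unit c'.2))) divrK // mul1r.
rewrite (eq_prim_root_expr w_prim) !modn_small // (inj_eq val_inj).
by rewrite mulrCA !rmorphM /= !rmorph_nat.
Qed.

(** All primitive [k]-th roots of unity have the same minimal polynomial over the
    rationals. *)
Lemma root_int_poly_unity (k : nat) (z w : algC) (f : {poly int}) :
  k.-primitive_root z -> k.-primitive_root w ->
  root (map_poly intr f) z -> root (map_poly intr f) w.
Proof.
have -> : map_poly (intr : int -> algC) f =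
    map_poly (ratr : rat -> algC) (map_poly (intr : int -> rat) f).
  rewrite -map_poly_comp; apply: eq_map_poly => a /=.
  by rewrite rmorph_int.
move=> z_prim w_prim.
have [q [minz _ ->]] := minCpolyP z; have [q' [minw _ ->]] := minCpolyP w.
have -> // : q = q'.
apply: (map_poly_inj (ratr : rat -> algC)); rewrite -minz -minw.
by rewrite (minCpoly_cyclotomic z_prim) (minCpoly_cyclotomic w_prim) -!Cintr_Cyclotomic.
Qed.

Lemma root_geometric (K : fieldType) (k : nat) (x : K) :
  x ^+ k = 1 -> x != 1 -> root (map_poly intr (\poly_(i < k) (1 : int))) x.
Proof.
move=> xk1 x_neq1; rewrite rootE.
have -> : map_poly intr (\poly_(i < k) (1 : int)) = \poly_(i < k) (1 : K).
  by apply/polyP => i; rewrite coef_map !coef_poly; case: ifP.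
rewrite horner_poly (eq_bigr (fun i : 'I_k => x ^+ i)) => [|i _]; last exact: mul1r.
by rewrite sum_unity_root // (negPf x_neq1) mulr0.
Qed.

Lemma root_int_poly_Frobenius (K : fieldType) (p : nat) (f : {poly int}) (x : K) (i : nat) :
  p \in [pchar K] -> root (map_poly intr f) x -> root (map_poly intr f) (x ^+ (p ^ i)).
Proof.
move=> charKp fx0; elim: i => [|i IH]; first by rewrite expn0 expr1.
rewrite expnSr exprM -(pFrobenius_autE charKp).
have /(rmorph_root (pFrobenius_aut charKp)) := IH.
rewrite -map_poly_comp; congr root; apply: eq_map_poly => a /=.
by rewrite rmorph_int.
Qed.

(** The term dropped from Parseval's identity is the value at the root of unity
    [1], that is, the sum of the coefficients. *)
Lemma Parseval_nontrivial (d : nat) (w : algC) (l : seq (int * 'I_d.+1)) :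
  d.+1.-primitive_root w ->
  \sum_(i < d) `|exponential_sum (w ^+ i.+1) l| ^+ 2 =
  (d.+1%:R * coef_norm l - coef_sum l ^+ 2)%:~R.
Proof.
move=> w_prim; have := Parseval l w_prim.
rewrite big_ord_recl expr0 => /(canRL (addKr _)) -> /=.
rewrite rmorphB addrC /=; congr (_ - _).
rewrite rmorphXn /= rmorph_sum /exponential_sum.
rewrite (eq_bigr (fun c => c.1%:~R)) => [|c _]; last by rewrite expr1n mulr1.
by rewrite -rmorph_sum real_normK ?Rreal_int // intr_int.
Qed.

Lemma coef_sum_Cauchy_Schwarz (d : nat) (l : seq (int * 'I_d.+1)) :
  coef_sum l ^+ 2 <= d.+1%:R * coef_norm l.
Proof.
have [w w_prim] := C_prim_root_exists (ltn0Sn d).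
rewrite -subr_ge0 -(ler0z algC) -(Parseval_nontrivial l w_prim).
by apply: sumr_ge0 => i _; rewrite exprn_ge0 ?normr_ge0.
Qed.

(** [T] is the sum of the squared absolute values of the conjugates of the lifted
    sum, so the inequality of arithmetic and geometric means bounds its norm [N]
    from above by [N^2 (k-1)^(k-1) <= T^(k-1)].  If the sum vanishes in
    characteristic [p], so do its [t] images under the Frobenius, whence [p^t]
    divides [N]; and [N] is nonzero as soon as [T] is, since a single vanishing
    conjugate makes all of them vanish. *)
Lemma vanishing_sum_bound (K : fieldType) (p k t : nat) (z : K)
    (l : seq (int * 'I_k)) :
  prime k -> p \in [pchar K] -> k.-primitive_root z ->
  injective (fun i : 'I_t => z ^+ (p ^ i)) ->
  exponential_sum z l = 0 ->
  let T := k%:R * coef_norm l - coef_sum l ^+ 2 in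
  T != 0 -> (p ^ t)%N%:R ^+ 2 * k.-1%:R ^+ k.-1 <= T ^+ k.-1.
Proof.
move=> k_prime charKp z_prim z_inj sum0 T.
have [w w_prim] := C_prim_root_exists (prime_gt0 k_prime).
case: k => // d in k_prime z z_prim z_inj l w w_prim sum0 T *.
rewrite [d.+1.-1]/= => T_neq0.
have coprime_k m : (0 < m < d.+1)%N -> coprime m d.+1.
  case/andP=> m_gt0 lt_m; rewrite coprime_sym prime_coprime //.
  by apply/negP => /(dvdn_leq m_gt0); rewrite leqNgt lt_m.
(* Frobenius conjugates of [z] are the common roots of [f] and [Phi]. *)
pose f : {poly int} := \sum_(c <- l) c.1 *: 'X^(c.2).
have fE (R : comNzRingType) (x : R) : (map_poly intr f).[x] = exponential_sum x l.
  rewrite /f rmorph_sum horner_sum; apply: eq_bigr => c _ /=.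
  by rewrite map_polyZ map_polyXn hornerZ hornerXn.
pose Phi : {poly int} := \poly_(i < d.+1) 1.
have Phi_monic : Phi \is monic by rewrite monicE lead_coef_poly.
have szPhi : size Phi = d.+1 by rewrite size_poly_eq.
pose r (i : 'I_d) := w ^+ i.+1.
have r_prim i : d.+1.-primitive_root (r i).
  by rewrite prim_root_exp_coprime // coprime_k /= ?ltnS.
have prim_neq1 (R : idomainType) (x : R) : d.+1.-primitive_root x -> x != 1.
  move=> x_prim; rewrite -[x]expr1 -(prim_order_dvd x_prim) dvdn1.
  by rewrite neq_ltn prime_gt1 ?orbT.
have rootr i : root (map_poly intr Phi) (r i).
  by rewrite root_geometric ?prim_neq1 ?prim_expr_order.
have r_inj : injective r.
  move=> i j /eqP; rewrite (eq_prim_root_expr w_prim) !modn_small ?ltnS //.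
  by move/eqP=> [] /val_inj.
pose x (i : 'I_t) := z ^+ (p ^ i).
have x_prim i : d.+1.-primitive_root (x i).
  rewrite prim_root_exp_coprime // coprimeXl // prime_coprime ?(pcharf_prime charKp) //.
  by apply/negP => /(prim_root_pcharF z_prim); rewrite charKp.
have rootx i : root (map_poly intr Phi) (x i).
  by rewrite root_geometric ?prim_neq1 ?prim_expr_order.
have fx0 i : root (map_poly intr f) (x i).
  by apply: root_int_poly_Frobenius => //; rewrite rootE fE sum0.
have [N NE dvdN] :=
  dvdz_prod_horner_roots charKp Phi_monic szPhi r_inj rootr z_inj rootx fx0.
have sumT : \sum_(i < d) `|exponential_sum (r i) l| ^+ 2 = T%:~R.
  exact: Parseval_nontrivial.
have N_neq0 : N != 0.
  apply: contraNneq T_neq0 => N0; move/eqP: NE; rewrite N0 eq_sym.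
  case/prodf_eq0 => i _; rewrite -/(root _ _) => fri.
  rewrite -(intr_eq0 algC) -sumT big1 // => j _.
  by rewrite -fE (rootP (root_int_poly_unity (r_prim i) (r_prim j) fri)) normr0 expr0n.
have le_pN : (p ^ t)%N%:R ^+ 2 <= N ^+ 2 :> int.
  rewrite -[N ^+ 2]real_normK ?num_real // lerXn2r ?nnegrE ?ler0n //.
  have := dvdn_leq _ dvdN; rewrite absz_gt0 => /(_ N_neq0).
  by rewrite -lez_nat abszE natz.
apply: le_trans (ler_wpM2r (exprn_ge0 _ (ler0n _ _)) le_pN) _.
have f_ge0 : {in 'I_d, forall i, 0 <= `|exponential_sum (r i) l| ^+ 2}.
  by move=> i _; rewrite exprn_ge0 ?normr_ge0.
have := (leif_AGM f_ge0).1.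
rewrite (eq_bigl xpredT) // [X in X / _](eq_bigl xpredT) // card_ord /= sumT.
rewrite expr_div_n ler_pdivlMr; last first.
  by rewrite exprn_gt0 // ltr0n -ltnS prime_gt1.
rewrite prodrXl -normr_prod (eq_bigr (fun i => (map_poly intr f).[r i])) => [|i _];
  last by rewrite fE.
rewrite -NE real_normK ?Rreal_int ?intr_int // -rmorphXn /=.
by rewrite -(rmorph_nat (intr : int -> algC)) -!rmorphXn /= -rmorphM /= ler_int.
Qed.

Lemma coef_norm_uniq (T : eqType) (l : seq (int * T)) :
  uniq (unzip2 l) -> coef_norm l = \sum_(c <- l) c.1 ^+ 2.
Proof.
move=> uniq_l; have uniq_l' := map_uniq uniq_l.
apply: eq_big_seq => c lc.
rewrite (bigD1_seq c) //= eqxx mulr1 big_seq_cond big1 ?addr0 // => c' /andP[lc' c'_neq].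
case: eqP => [/eqP eq_cc'|]; last by rewrite mulr0.
move: c'_neq; rewrite -(nth_index c lc) -(nth_index c lc').
rewrite nth_uniq ?index_mem // -(nth_uniq c.2 _ _ uniq_l) ?size_map ?index_mem //.
by rewrite !(nth_map c) ?index_mem // !nth_index // eq_sym eq_cc'.
Qed.

(** The conclusion is the equality case of the Cauchy-Schwarz inequality on the
    group of [k]-th roots of unity: all the coefficients are equal, so that the
    relation is a multiple of the obvious one, the vanishing of the sum of all
    [k]-th roots of unity.  The bound [9] on the squares is what turns into the
    factor [3^(k-1)] of the lower bound required of [p^t]. *)
Definition short_relations_trivial (K : fieldType) (k : nat) : Prop :=
  forall l : seq (int * K),
    uniq (unzip2 l) -> {in unzip2 l, forall x, x ^+ k = 1} ->
    \sum_(c <- l) c.1%:~R * c.2 = 0 -> \sum_(c <- l) c.1 ^+ 2 <= 9 ->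
    k%:R * (\sum_(c <- l) c.1 ^+ 2) = (\sum_(c <- l) c.1) ^+ 2.

(** This is [(1 - 1/(d+1))^d >= 1/(d+1)], a case of Bernoulli's inequality, whose
    partial steps [(1 - 1/(d+1))^j >= 1 - j/(d+1)] are proved by induction. *)
Lemma leq_expn_succ (d : nat) : (d.+1 ^ d <= d.+1 * d ^ d)%N.
Proof.
have Bernoulli j : (j <= d -> d.+1 ^ j * (d.+1 - j) <= d.+1 * d ^ j)%N.
  elim: j => [|j IH] lt_jd; first by rewrite mul1n subn0 muln1.
  rewrite !expnSr mulnA; apply: leq_trans (leq_mul (IH (ltnW lt_jd)) (leqnn d)).
  rewrite -!mulnA leq_mul2l; apply/orP; right.
  rewrite subSS subSn ?(ltnW lt_jd) // mulSn [(_.+1 * d)%N]mulSn mulnC.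
  by rewrite leq_add2r leq_subr.
by have := Bernoulli d (leqnn d); rewrite subSnn muln1.
Qed.

(** A relation that is not trivial has [0 < T <= 9k] in [vanishing_sum_bound], so
    that [p^(2t) <= 9^(k-1) (k/(k-1))^(k-1) <= 9^(k-1) k]. *)
Lemma large_order_rigid (K : fieldType) (p k t : nat) (z : K) :
  prime k -> p \in [pchar K] -> k.-primitive_root z ->
  injective (fun i : 'I_t => z ^+ (p ^ i)) ->
  (3 ^ k.-1 * k < p ^ t)%N -> short_relations_trivial K k.
Proof.
move=> k_prime charKp z_prim z_inj large l uniq_l unity_l sum0.
rewrite -(coef_norm_uniq uniq_l) -/(coef_sum l) {uniq_l} => norm_le9.
have [l' def_l] :
    exists l' : seq (int * 'I_k), l = [seq (c.1, z ^+ c.2) | c : int * 'I_k <- l'].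
  elim: l unity_l {sum0 norm_le9} => [|[m x] l IH] /= unity_l; first by exists [::].
  have [i ->] := prim_rootP z_prim (unity_l x (mem_head _ _)).
  have [y ly|l' ->] := IH; first by rewrite unity_l // inE ly orbT.
  by exists ((m, i) :: l').
have normE : coef_norm [seq (c.1, z ^+ c.2) | c : int * 'I_k <- l'] = coef_norm l'.
  rewrite /coef_norm big_map; apply: eq_bigr => c _.
  rewrite big_map; apply: eq_bigr => c' _ /=.
  by rewrite (eq_prim_root_expr z_prim) !modn_small // (inj_eq val_inj).
have sumE : coef_sum [seq (c.1, z ^+ c.2) | c : int * 'I_k <- l'] = coef_sum l'.
  by rewrite /coef_sum big_map.
rewrite {l unity_l}def_l normE sumE big_map /= in sum0 norm_le9 *.
apply/eqP; rewrite -subr_eq0; apply: contraLR large => T_neq0; rewrite -leqNgt.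
have := vanishing_sum_bound k_prime charKp z_prim z_inj sum0 T_neq0.
set T := _ - _ => le_T.
move: norm_le9; case: k k_prime l' @T le_T {z_prim sum0 normE sumE T_neq0} => //
  d k_prime l' T.
rewrite [d.+1.-1]/= => le_T norm_le9.
have T_ge0 : 0 <= T by rewrite subr_ge0 coef_sum_Cauchy_Schwarz.
have T_le : T <= (9 * d.+1)%N%:R.
  by rewrite lerBlDr mulnC natrM ler_wpDr ?sqr_ge0 // ler_wpM2l.
have {T_ge0 T_le}le_Td : T ^+ d <= (9 * d.+1)%N%:R ^+ d.
  by rewrite lerXn2r // nnegrE ler0n.
have := le_trans le_T le_Td; rewrite -!natrX -natrM ler_nat => le_p.
have d_gt0 : (0 < d)%N by rewrite -ltnS prime_gt1.
have dd_gt0 : (0 < d ^ d)%N by rewrite expn_gt0 d_gt0.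
rewrite -leq_sqr -(leq_pmul2r dd_gt0); apply: leq_trans le_p _.
rewrite expnMn [X in (_ <= X * _)%N]expnMn -mulnA -[9%N]/(3 ^ 2)%N.
rewrite -!expnM [(2 * d)%N]mulnC leq_mul //; apply: leq_trans (leq_expn_succ d) _.
by rewrite leq_pmul2r // -[leqLHS]expn1 leq_pexp2l.
Qed.

(** * Triples of roots of unity with equal sum and product *)

Lemma no_balanced_relation (K : fieldType) (k : nat) (l : seq (int * K)) :
  (0 < k)%N -> short_relations_trivial K k ->
  uniq (unzip2 l) -> {in unzip2 l, forall x, x ^+ k = 1} ->
  \sum_(c <- l) c.1%:~R * c.2 = 0 -> \sum_(c <- l) c.1 = 0 ->
  0 < \sum_(c <- l) c.1 ^+ 2 <= 9 -> False.
Proof.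
move=> k_gt0 rigid uniq_l unity_l sum0 coef0 /andP[norm_gt0 norm_le9].
have /eqP := rigid l uniq_l unity_l sum0 norm_le9.
by rewrite coef0 expr0n mulf_eq0 pnatr_eq0 -leqn0 leqNgt k_gt0 gt_eqF.
Qed.

Lemma unity_root_neq0 (R : nzRingType) (k : nat) (x : R) :
  (0 < k)%N -> x ^+ k = 1 -> x != 0.
Proof.
move=> k_gt0 xk; apply: contra_eq_neq xk => ->.
by rewrite expr0n gtn_eqF //= eq_sym oner_eq0.
Qed.

(** Eliminating [P'] leaves [(P - N) (N'P + N'N - 2P^2) = 0], and the second
    factor is a short relation with coefficient sum zero. *)
Lemma double_coincidence (K : fieldType) (k : nat) (P P' N N' : K) :
  (0 < k)%N -> short_relations_trivial K k ->
  P ^+ k = 1 -> N ^+ k = 1 -> N' ^+ k = 1 ->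
  P + P + P' = N + N + N' -> P * P * P' = N * N * N' -> P = N.
Proof.
move=> k_gt0 rigid Pk Nk N'k eq_sum eq_prod; apply/eqP/negP => /negP P_neqN.
have unityM (x y : K) : x ^+ k = 1 -> y ^+ k = 1 -> (x * y) ^+ k = 1.
  by move=> xk yk; rewrite exprMn xk yk mulr1.
have N'_neq0 := unity_root_neq0 k_gt0 N'k.
have NP_neq : N' * P != N' * N by rewrite (inj_eq (mulfI N'_neq0)).
have rel : N' * P + N' * N = P * P + P * P.
  apply/eqP; rewrite -subr_eq0.
  suff : (P - N) * (N' * P + N' * N - (P * P + P * P)) == 0.
    by rewrite mulf_eq0 [P - N == 0]subr_eq0 (negPf P_neqN).
  have def_P' : P' = N + N + N' - P - P by rewrite -eq_sum; ring.
  have /eqP := eq_prod; rewrite -subr_eq0 def_P' => /eqP eq_prod0.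
  by apply/eqP; rewrite -eq_prod0; ring.
(* [P * P] may coincide with one of the two other terms, but not with both. *)
have [N'P_eq|N'P_neq] := eqVneq (N' * P) (P * P).
  apply: (@no_balanced_relation _ _ [:: (1, N' * N); (-1, P * P)] k_gt0 rigid);
    rewrite ?big_cons ?big_nil //=.
  - by rewrite inE -N'P_eq eq_sym NP_neq.
  - by move=> x; rewrite !inE => /orP[] /eqP ->; exact: unityM.
  - rewrite mulN1r mul1r addr0; apply/eqP.
    by rewrite subr_eq0 -(inj_eq (addrI (P * P))) -rel N'P_eq.
have [N'N_eq|N'N_neq] := eqVneq (N' * N) (P * P).
  apply: (@no_balanced_relation _ _ [:: (1, N' * P); (-1, P * P)] k_gt0 rigid);
    rewrite ?big_cons ?big_nil //=.
  - by rewrite inE N'P_neq.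
  - by move=> x; rewrite !inE => /orP[] /eqP ->; exact: unityM.
  - rewrite mulN1r mul1r addr0; apply/eqP.
    by rewrite subr_eq0 -(inj_eq (addIr (P * P))) -rel N'N_eq.
apply: (@no_balanced_relation _ _
  [:: (1, N' * P); (1, N' * N); (-2, P * P)] k_gt0 rigid);
  rewrite ?big_cons ?big_nil //=.
- by rewrite !inE negb_or NP_neq N'P_neq N'N_neq.
- by move=> x; rewrite !inE => /or3P[] /eqP ->; exact: unityM.
- rewrite !mul1r addr0 addrA rel; ring.
Qed.

Lemma unity_root_extraction (K : fieldType) (k j : nat) :
  (0 < j)%N -> coprime j k ->
  exists m, forall x : K, x ^+ k = 1 -> x ^+ m ^+ j = x.
Proof.
move=> j_gt0 /eqP co_jk; case: (egcdnP k j_gt0) => m n; rewrite co_jk => eq_mj _.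
exists m => x xk1.
by rewrite -exprM eq_mj addn1 exprS mulnC exprM xk1 expr1n mulr1.
Qed.

Lemma unity_root_sqr_inj (K : fieldType) (k : nat) (x y : K) :
  odd k -> x ^+ k = 1 -> y ^+ k = 1 -> x ^+ 2 = y ^+ 2 -> x = y.
Proof.
move=> odd_k xk1 yk1 eq_xy; have /eqP := eq_xy; rewrite eqf_sqr => /orP[/eqP //|/eqP def_x].
have := xk1; rewrite def_x exprNn yk1 mulr1 -signr_odd odd_k expr1 => eq_N1.
by rewrite -mulN1r eq_N1 mul1r.
Qed.

(** The relation [A + B + C = 3] has [12] as its sum of squares, too large to be
    excluded at once.  With cube roots [a], [b], [c] such that [abc = 1] it reads
    [a^3 + b^3 + c^3 - 3abc = 0], which factors into the two short relations
    [a + b + c = 0] and [a^2 + b^2 + c^2 = ab + bc + ca].  Cube roots exist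
    because the four distinct roots [1], [A], [B], [C] force [k > 3]. *)
Lemma no_cubic_coincidence (K : fieldType) (k : nat) (A B C : K) :
  prime k -> short_relations_trivial K k ->
  uniq [:: 1; A; B; C] -> A ^+ k = 1 -> B ^+ k = 1 -> C ^+ k = 1 ->
  A + B + C = 3 -> A * B * C = 1 -> False.
Proof.
move=> k_prime rigid uniqABC Ak Bk Ck eq_sum eq_prod.
have k_gt0 := prime_gt0 k_prime.
have k_gt3 : (3 < k)%N.
  apply: (max_unity_roots k_gt0 _ uniqABC).
  by rewrite /= !unity_rootE expr1n Ak Bk Ck eqxx.
have odd_k : odd k by case: (even_prime k_prime) k_gt3 => [->|].
have co3k : coprime 3 k.
  by rewrite prime_coprime // dvdn_prime2 // neq_ltn k_gt3.
have [m cubeK] := @unity_root_extraction K k 3 isT co3k.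
pose a := A ^+ m; pose b := B ^+ m; pose c := C ^+ m.
have unityX (x : K) : x ^+ k = 1 -> (x ^+ m) ^+ k = 1.
  by move=> xk; rewrite exprAC xk expr1n.
have [ak bk ck] : [/\ a ^+ k = 1, b ^+ k = 1 & c ^+ k = 1] by split; exact: unityX.
have [a3 b3 c3] : [/\ a ^+ 3 = A, b ^+ 3 = B & c ^+ 3 = C] by split; exact: cubeK.
have abc1 : a * b * c = 1 by rewrite -!exprMn eq_prod expr1n.
have [a0 b0 c0] : [/\ a != 0, b != 0 & c != 0].
  by split; apply: (unity_root_neq0 k_gt0).
have [[A1 B1 C1] [AB AC BC]] :
    [/\ A != 1, B != 1 & C != 1] /\ [/\ A != B, A != C & B != C].
  move: uniqABC; rewrite /= !inE !negb_or ![1 == _]eq_sym.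
  by case/and4P=> /and3P[] ? ? ? /andP[] ? ? ? _.
have [ab ac bc] : [/\ a != b, a != c & b != c].
  split; [move: AB | move: AC | move: BC]; rewrite -?a3 -?b3 -?c3;
    by apply: contraNneq => ->.
have /eqP : (a + b + c) * (a ^+ 2 + b ^+ 2 + c ^+ 2 - a * b - b * c - c * a) = 0.
  transitivity (A + B + C - 3 * (a * b * c)); first by rewrite -a3 -b3 -c3; ring.
  by rewrite eq_sum abc1; ring.
rewrite mulf_eq0 => /orP[/eqP sum0 | /eqP quad0].
  have unity3 : {in [:: a; b; c], forall x, x ^+ k = 1}.
    by move=> x; rewrite !inE => /or3P[] /eqP ->.
  have := rigid [:: (1, a); (1, b); (1, c)]; rewrite !big_cons !big_nil /=.
  rewrite !inE !negb_or ab ac bc !mul1r addr0 addrA sum0.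
  move=> /(_ isT unity3 erefl isT) k3_eq9.
  have /eqP : (k * 3)%N%:R = 9%:R :> int by rewrite natrM; exact: k3_eq9.
  by rewrite eqr_nat -[9%N]/(3 * 3)%N eqn_pmul2r // gtn_eqF.
have ne_sqr (x y : K) : x ^+ k = 1 -> y ^+ k = 1 -> x != y -> x ^+ 2 != y ^+ 2.
  by move=> xk yk; apply: contra_neq => /(unity_root_sqr_inj odd_k xk yk).
(* A square equal to the opposite mixed product has a cube equal to [abc = 1]. *)
have ne_opp (x y w : K) : x * (y * w) = 1 -> x ^+ 3 != 1 -> x ^+ 2 != y * w.
  by move=> xyw1; apply: contra_neq => eq_x2; rewrite exprS eq_x2.
have a2_bc : a ^+ 2 != b * c by rewrite ne_opp ?a3 // mulrA.
have b2_ca : b ^+ 2 != c * a by rewrite ne_opp ?b3 // mulrA mulrC mulrA.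
have c2_ab : c ^+ 2 != a * b by rewrite ne_opp ?c3 // mulrC.
have ab_bc : a * b != b * c by rewrite mulrC (inj_eq (mulfI b0)).
have ab_ca : a * b != c * a by rewrite mulrC (inj_eq (mulIf a0)).
have bc_ca : b * c != c * a by rewrite mulrC (inj_eq (mulfI c0)) eq_sym.
apply: (@no_balanced_relation _ _ [:: (1, a ^+ 2); (1, b ^+ 2); (1, c ^+ 2);
   (-1, a * b); (-1, b * c); (-1, c * a)] k_gt0 rigid); rewrite ?big_cons ?big_nil //=.
- rewrite !inE !negb_or !ne_sqr // a2_bc b2_ca c2_ab ab_bc ab_ca bc_ca !expr2.
  rewrite !(inj_eq (mulfI a0)) !(inj_eq (mulIf a0)) !(inj_eq (mulfI b0)).
  rewrite !(inj_eq (mulIf b0)) !(inj_eq (mulfI c0)) !(inj_eq (mulIf c0)).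
  by rewrite ab ac bc ![b == a]eq_sym ![c == _]eq_sym ab ac bc.
- move=> x; rewrite !inE.
  by case/or4P=> [/eqP->|/eqP->|/eqP->|/or3P[]/eqP->];
    rewrite ?exprMn ?[_ ^+ 2 ^+ k]exprAC ?ak ?bk ?ck ?mulr1 ?expr1n.
- by apply: etrans quad0; rewrite !mul1r !mulN1r; ring.
Qed.

Lemma nonuniq_triple (T : eqType) (s : seq T) :
  size s = 3 -> ~~ uniq s -> exists x y, perm_eq s [:: x; x; y].
Proof.
case: s => [|a [|b [|c [|]]]] //= _; rewrite !inE !negb_or !negb_and !negbK orbF.
case/orP=> [/orP[] /eqP->|/eqP->].
- by exists b, c.
- by exists c, b; rewrite perm_cons (permEl (perm_catC [:: b] [:: c])).
- by exists c, a; exact: (permEl (perm_catC [:: a] [:: c; c])).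
Qed.

(** If the triples are disjoint, their difference has [6] as its sum of squares
    when [N] has distinct entries and [3 + 4 + 1 = 8] when it has one repetition;
    both are excluded as short relations, and a constant [N] is the cubic case,
    after division by its entry. *)
Lemma uniq_triples_meet (K : fieldType) (k : nat) (P N : seq K) :
  prime k -> short_relations_trivial K k ->
  size P = 3 -> size N = 3 -> {in P ++ N, forall x, x ^+ k = 1} ->
  \sum_(x <- P) x = \sum_(x <- N) x -> \prod_(x <- P) x = \prod_(x <- N) x ->
  uniq P -> has (mem N) P.
Proof.
move=> k_prime rigid szP szN unityPN eq_sum eq_prod uniqP.
have k_gt0 := prime_gt0 k_prime; apply/negP => /negP disjPN.
have sum_scaled (m : int) (s : seq K) :
    \sum_(c <- [seq (m, x) | x <- s]) c.1%:~R * c.2 = m%:~R * \sum_(x <- s) x.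
  by rewrite big_map mulr_sumr.
have unzipE (m : int) (s : seq K) : unzip2 [seq (m, x) | x <- s] = s.
  by rewrite /unzip2 -map_comp map_id.
have [uniqN|] := boolP (uniq N).
  apply: (@no_balanced_relation _ _
    ([seq (1, x) | x <- P] ++ [seq (-1, x) | x <- N]) k_gt0 rigid).
  - by rewrite /unzip2 map_cat -!/(unzip2 _) !unzipE cat_uniq uniqP uniqN has_sym disjPN.
  - by rewrite /unzip2 map_cat -!/(unzip2 _) !unzipE.
  - by rewrite big_cat /= !sum_scaled eq_sum mul1r mulN1r subrr.
  - by rewrite big_cat /= !big_map !big_const_seq !count_predT szP szN.
  - by rewrite big_cat /= !big_map !big_const_seq !count_predT szP szN.
case/nonuniq_triple=> // x [y permN].
have unityP : {in P, forall z, z ^+ k = 1}.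
  by move=> z Pz; rewrite unityPN // mem_cat Pz.
have unityN : {in [:: x; x; y], forall z, z ^+ k = 1}.
  by move=> z; rewrite -(perm_mem permN) => Nz; rewrite unityPN // mem_cat Nz orbT.
have xk : x ^+ k = 1 by rewrite unityN ?mem_head.
have yk : y ^+ k = 1 by rewrite unityN // !inE eqxx !orbT.
rewrite (perm_big _ permN) /= in eq_sum; rewrite (perm_big _ permN) /= in eq_prod.
rewrite (eq_has (perm_mem permN)) in disjPN.
have [xP yP] : x \notin P /\ y \notin P.
  by move: disjPN; rewrite has_sym /= orbA orbb orbF negb_or => /andP[].
have [eq_xy|x_neq_y] := eqVneq x y; last first.
  apply: (@no_balanced_relation _ _
    ([:: (-2, x); (-1, y)] ++ [seq (1, z) | z <- P]) k_gt0 rigid).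
  - by rewrite /= unzipE inE negb_or x_neq_y xP yP.
  - move=> z; rewrite /= unzipE !inE => /or3P[/eqP-> | /eqP-> | /unityP] //.
  - rewrite big_cat /= sum_scaled eq_sum !big_cons !big_nil /=; ring.
  - by rewrite big_cat /= !big_cons big_nil !big_map !big_const_seq !count_predT szP.
  - by rewrite big_cat /= !big_cons big_nil !big_map !big_const_seq !count_predT szP.
case: P szP uniqP xP unityP eq_sum eq_prod {unityPN disjPN yP} => [|A [|B [|C [|]]]] //=.
rewrite -eq_xy !big_cons !big_nil !addr0 !mulr1 !inE !negb_or !andbT.
move=> _ /andP[/andP[AB AC] BC] /and3P[xA xB xC] unityABC eq_sum eq_prod.
have x_neq0 := unity_root_neq0 k_gt0 xk.
have div_inj : injective (fun z => z / x) by apply: mulIf; rewrite invr_eq0.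
have unityV z : z \in [:: A; B; C] -> (z / x) ^+ k = 1.
  by move=> /unityABC zk; rewrite exprMn exprVn zk xk invr1 mulr1.
apply: (@no_cubic_coincidence _ k (A / x) (B / x) (C / x)) => //.
- rewrite -(divff x_neq0) (map_inj_uniq div_inj [:: x; A; B; C]).
  by rewrite /= !inE !negb_or xA xB xC AB AC BC.
- by rewrite unityV ?mem_head.
- by rewrite unityV // !inE eqxx orbT.
- by rewrite unityV // !inE eqxx !orbT.
- by rewrite -!mulrDl -addrA eq_sum; field.
- transitivity ((A * (B * C)) / x ^+ 3); first by field.
  by rewrite eq_prod; field.
Qed.

(** When both triples have a repetition, the repeated entries agree. *)
Lemma triples_meet (K : fieldType) (k : nat) (P N : seq K) :
  prime k -> short_relations_trivial K k ->
  size P = 3 -> size N = 3 -> {in P ++ N, forall x, x ^+ k = 1} ->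
  \sum_(x <- P) x = \sum_(x <- N) x -> \prod_(x <- P) x = \prod_(x <- N) x ->
  has (mem N) P.
Proof.
move=> k_prime rigid szP szN unityPN eq_sum eq_prod.
have [uniqP|] := boolP (uniq P); first exact: (uniq_triples_meet k_prime rigid).
have [uniqN _|nuniqN nuniqP] := boolP (uniq N).
  rewrite has_sym (uniq_triples_meet k_prime rigid) // => x.
  by rewrite mem_cat orbC -mem_cat => /unityPN.
have [x [x' permP]] := nonuniq_triple szP nuniqP.
have [y [y' permN]] := nonuniq_triple szN nuniqN.
have unityP z : z \in [:: x; x; x'] -> z ^+ k = 1.
  by rewrite -(perm_mem permP) => Pz; rewrite unityPN // mem_cat Pz.
have unityN z : z \in [:: y; y; y'] -> z ^+ k = 1.
  by rewrite -(perm_mem permN) => Nz; rewrite unityPN // mem_cat Nz orbT.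
rewrite !(perm_big _ permP) !(perm_big _ permN) /= in eq_sum eq_prod.
rewrite !big_cons !big_nil !addr0 !mulr1 !addrA !mulrA in eq_sum eq_prod.
have eq_xy : x = y.
  apply: (double_coincidence (prime_gt0 k_prime) rigid _ _ _ eq_sum eq_prod).
  - by rewrite unityP ?mem_head.
  - by rewrite unityN ?mem_head.
  - by rewrite unityN // !inE eqxx !orbT.
apply/hasP; exists x; first by rewrite (perm_mem permP) mem_head.
by rewrite inE (perm_mem permN) eq_xy mem_head.
Qed.

(** * Cyclotomic numbers *)

Lemma mult_order_inj (K : fieldType) (k p : nat) (z : K) :
  prime k -> coprime k p -> k.-primitive_root z ->
  injective (fun i : 'I_(mult_order k p) => z ^+ (p ^ i)).
Proof.
move=> k_prime co_kp z_prim i j /eqP; rewrite (eq_prim_root_expr z_prim) => eq_pij.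
have k_gt1 := prime_gt1 k_prime.
apply/val_inj/eqP => /=; move: i j eq_pij; rewrite /mult_order.
have p_unit : (p%:R : 'Z_k) \is a GRing.unit by rewrite unitZpE.
set u := insubd _ _; have val_u : val u = p%:R by rewrite /u insubdK.
move=> i j eq_pij; rewrite -(modn_small (ltn_ord i)) -(modn_small (ltn_ord j)).
rewrite -eq_expg_mod_order -val_eqE /= !FinRing.val_unitX val_u -!natrX.
by rewrite -val_eqE /= !val_Zp_nat.
Qed.

(** Three solutions are three points [(x, 1 + x)] on a line, so the determinant of
    the matrix with rows [(1, x, 1 + x)] vanishes.  Its six terms, scaled by
    [alpha * beta], are [k]-th roots of unity, and the three even ones have the
    same product as the three odd ones, namely the product of all the entries.
    An even term equal to an odd one makes two of the solutions equal. *)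
Lemma at_most_two_solutions (K : fieldType) (k : nat) (alpha beta : K)
   (x1 x2 x3 : K) :
  prime k -> short_relations_trivial K k -> alpha != 0 -> beta != 0 ->
  {in [:: x1; x2; x3], forall x, x ^+ k = alpha ^+ k /\ (1 + x) ^+ k = beta ^+ k} ->
  ~~ uniq [:: x1; x2; x3].
Proof.
move=> k_prime rigid alpha0 beta0 sol; apply/negP => uniqx.
have k_gt0 := prime_gt0 k_prime.
have s_neq0 : alpha * beta != 0 by rewrite mulf_neq0.
have nonzero x : x \in [:: x1; x2; x3] -> x != 0 /\ 1 + x != 0.
  move=> /sol[xk yk]; split.
    by have := expf_neq0 k alpha0; rewrite -xk expf_eq0 k_gt0.
  by have := expf_neq0 k beta0; rewrite -yk expf_eq0 k_gt0.
pose v x x' := x * (1 + x') / (alpha * beta).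
have v_unity x x' : x \in [:: x1; x2; x3] -> x' \in [:: x1; x2; x3] -> v x x' ^+ k = 1.
  move=> /sol[xk _] /sol[_ yk].
  by rewrite exprMn exprVn !exprMn xk yk divff // mulf_neq0 ?expf_neq0.
have v_inj x y x' y' : v x y = v x' y' -> x * (1 + y) = x' * (1 + y').
  by apply: mulIf; rewrite invr_eq0.
have [X1 X2 X3] : [/\ x1 \in [:: x1; x2; x3], x2 \in [:: x1; x2; x3]
    & x3 \in [:: x1; x2; x3]] by rewrite !inE !eqxx !orbT.
have v_swap x x' : v x x' = v x' x -> x = x'.
  by move/v_inj/eqP; rewrite !mulrDr !mulr1 [x' * x]mulrC (inj_eq (addIr _)) => /eqP.
have v_fst x y y' : x \in [:: x1; x2; x3] -> v x y = v x y' -> y = y'.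
  by move=> /nonzero[x0 _] /v_inj /(mulfI x0) /addrI.
have v_snd x x' y : y \in [:: x1; x2; x3] -> v x y = v x' y -> x = x'.
  by move=> /nonzero[_ y0] /v_inj /(mulIf y0).
have : has (mem [:: v x3 x2; v x1 x3; v x2 x1]) [:: v x2 x3; v x3 x1; v x1 x2].
  apply: (triples_meet k_prime rigid) => //.
  - by move=> x; rewrite mem_cat !inE -!orbA => /or4P[/eqP->|/eqP->|/eqP->|/or3P[]/eqP->];
      exact: v_unity.
  - by rewrite !big_cons !big_nil /v; field; rewrite alpha0 beta0.
  - by rewrite !big_cons !big_nil /v; field; rewrite alpha0 beta0.
move: uniqx; rewrite /= !inE !negb_or andbT => /andP[/andP[/eqP x12 /eqP x13] /eqP x23].
(* Two terms of opposite parity share their first factor, share their second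
   factor, or have the indices of their factors exchanged. *)
by case/or4P=> // /or3P[] /eqP;
  do ?[move/v_swap | move/(v_fst _ _ _ X1) | move/(v_fst _ _ _ X2) | move/(v_fst _ _ _ X3)
     | move/(v_snd _ _ _ X1) | move/(v_snd _ _ _ X2) | move/(v_snd _ _ _ X3)] => // /esym.
Qed.

Lemma root_powR_lt (R : realType) (a b t : nat) :
  (0 < t)%N -> (a%:R : R) `^ (1 / t%:R) < b%:R -> (a < b ^ t)%N.
Proof.
move=> t_gt0 root_lt; rewrite -(ltr_nat R) natrX.
have -> : a%:R = (a%:R `^ (1 / t%:R)) ^+ t :> R.
  by rewrite -powR_mulrn ?powR_ge0 // -powRrM mul1r mulVf ?pnatr_eq0 -?lt0n // powRr1.
by rewrite ltrXn2r ?nnegrE ?powR_ge0 ?ler0n // -lt0n.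
Qed.

Lemma cyclotomic_class_expr (F : finFieldType) (g : F) (e k : nat) (a : int) (x : F) :
  g ^+ (e * k) = 1 -> g != 0 -> x \in cyclotomic_class g e k a ->
  x ^+ k = (g ^ a) ^+ k.
Proof.
move=> gek g0 /imsetP[r _ ->]; rewrite expfzDr // exprMn -exprnP -exprM.
by rewrite -mulnA mulnC exprM gek expr1n mulr1.
Qed.

Theorem theorem2 (R : realType) (p n q e k : nat) (F : finFieldType) (g : F)
  (p_prime : prime p) (n_gt0 : (0 < n)%N) (q_pow : q = (p ^ n)%N)
  (e_div : nontrivial_divisor e (q - 1)) (k_div : nontrivial_divisor k (q - 1))
  (k_prime : prime k) (q_ek : q = (e * k + 1)%N)
  (cardF : #|F| = q) (g_prim : (q - 1)%N.-primitive_root g)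
  (p_large : (3 ^+ (k - 1) * k%:R : R) `^ (1 / (mult_order k p)%:R) < p%:R) :
  forall a b : int, (cyclotomic_number g e k a b <= 2)%N.
Proof.
move=> a b.
have q1E : (q - 1 = e * k)%N by rewrite q_ek addnK.
have q1_gt0 := prim_order_gt0 g_prim.
have charFp : p \in [pchar F] by apply: (@card_finPcharP _ p n); rewrite ?cardF.
have z_prim : k.-primitive_root (g ^+ e).
  have k_dvd : (k %| q - 1)%N by rewrite q1E dvdn_mull.
  by have := dvdn_prim_root g_prim k_dvd; rewrite q1E mulnK ?prime_gt0.
have co_kp : coprime k p.
  rewrite coprime_sym prime_coprime //; apply/negP => /(prim_root_pcharF z_prim).
  by rewrite charFp.
have rigid : short_relations_trivial F k.
  apply: (large_order_rigid k_prime charFp z_prim (mult_order_inj k_prime co_kp z_prim)).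
  apply: (@root_powR_lt R); first exact: order_gt0.
  by rewrite natrM natrX -subn1.
have g0 : g != 0 by rewrite (prim_root_eq0 g_prim) -lt0n.
rewrite leqNgt; apply/negP => /card_gt2P[u [v [w [[uS vS wS] [uv vw wu]]]]].
have gek : g ^+ (e * k) = 1 by rewrite -q1E prim_expr_order.
have solE (s : F * F) : s \in [:: u; v; w] ->
    [/\ s.2 = 1 + s.1, s.1 ^+ k = (g ^ a) ^+ k & (1 + s.1) ^+ k = (g ^ b) ^+ k].
  have /allP sub_sol : all (mem [set xy : F * F | [&& xy.1 \in cyclotomic_class g e k a,
      xy.2 \in cyclotomic_class g e k b & 1 + xy.1 == xy.2]]) [:: u; v; w].
    by apply/and4P.
  move=> /sub_sol; rewrite [mem _ _]inE => /and3P[xa yb /eqP eq_xy]; rewrite eq_xy.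
  by split=> //; apply: (cyclotomic_class_expr gek).
have fst_inj : {in [:: u; v; w] &, injective fst}.
  by case=> [x y] [x' y'] /solE[/= -> _ _] /solE[/= -> _ _] ->.
have ga0 c : g ^ c != 0 by rewrite expfz_neq0.
have uniq_fst : uniq [:: u.1; v.1; w.1].
  rewrite -[[:: _; _; _]]/(map fst [:: u; v; w]) map_inj_in_uniq //.
  by rewrite /= !inE negb_or uv vw eq_sym wu.
apply/negP: uniq_fst; apply: (at_most_two_solutions k_prime rigid (ga0 a) (ga0 b)).
move=> x; rewrite -[[:: _; _; _]]/(map fst [:: u; v; w]).
by move=> /mapP[s /solE[_ ? ?] ->]; split.
Qed.
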